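(* Suppose the following statement (D) holds: for every positive integer $m$, every pair of equivalence relations $\sim_1,\sim_2$ on $[m]=\{1,\dots,m\}$, and every Hermitian positive semidefinite $m\times m$ complex matrix $A$, \[\operatorname{Re}\Bigl(\sum_{\sigma_1\in P_1}\sum_{\sigma_2\in P_2}\prod_{i=1}^m A_{\sigma_1(i),\sigma_2(i)}\Bigr)\ \ge\ |P_1\cap P_2|\prod_{i=1}^m A_{ii},\] where $P_k$ is the group of permutations of $[m]$ mapping each $\sim_k$-equivalence class to itself. Then for every finite tree $T$ (connected, circuit-free, finite simple undirected graph) and every $\mathbf{x}\in C_T(\mathbb{R}^3)$, $\operatorname{Re}(\mathcal{A}_T(\mathbf{x}))\ge 1$.
   Context: For a finite simple undirected graph $H=(W,F)$, let $C_H(\mathbb{R}^3)$ be the set of maps $\mathbf{x}:W\to\mathbb{R}^3$ with $\mathbf{x}(a)\neq\mathbf{x}(b)$ whenever $\{a,b\}\in F$; write $\mathbf{x}_a=\mathbf{x}(a)$. Let $S_H=\{(a,b):\{a,b\}\in F\}$ (ordered pairs). Let $\sigma_1=\begin{pmatrix}0&1\\1&0\end{pmatrix}$, $\sigma_2=\begin{pmatrix}0&-i\\i&0\end{pmatrix}$, $\sigma_3=\begin{pmatrix}1&0\\0&-1\end{pmatrix}$ be the Pauli matrices and $v\cdot\vec\sigma=v^1\sigma_1+v^2\sigma_2+v^3\sigma_3$. For $(a,b)\in S_H$ set $v_{ab}=(\mathbf{x}_b-\mathbf{x}_a)/\|\mathbf{x}_b-\mathbf{x}_a\|$ and let $\psi_{ab}\in\mathbb{C}^2$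 be a unit vector with $(v_{ab}\cdot\vec\sigma)\psi_{ab}=\psi_{ab}$ (defined up to phase). Let $\omega((u_1,w_1)^T,(u_2,w_2)^T)=u_1w_2-u_2w_1$. Choose a subset $\Delta\subseteq S_H$ containing exactly one of $(a,b),(b,a)$ for each edge (an orientation). Define $T(\mathbf{x})=\bigl(\bigotimes_{(a,b)\in S_H}\psi_{ab}\bigr)/\prod_{(a,b)\in\Delta}\omega(\psi_{ab},\psi_{ba})\in\bigotimes_{(a,b)\in S_H}\mathbb{C}^2$, independent of phase choices. Permutations $\pi$ of $S_H$ act on the right by $(\bigotimes\phi_{ab}).\pi=\bigotimes\phi_{\pi(a,b)}$, extended linearly. Let $P_H$ be the group of permutations $\pi$ of $S_H$ with $\pi(a,b)$ having first entry $a$ for all $(a,b)$, and $p_H=\sum_{\pi\in P_H}\pi$. The $H$-amplitude $\mathcal{A}_H(\mathbf{x})\in\mathbb{C}$ is obtained by applying to $T(\mathbf{x}).p_H$ the linear functional determined by $\bigotimes_{(c,d)\in S_H}\phi_{cd}\mapsto\prod_{(a,b)\in\Delta}\omega(\phi_{ab},\phi_{ba})$; it is independent of the choice of $\Delta$. *)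

(* Defs.v *)
From HB Require Import structures.
From mathcomp Require Import all_boot all_order all_fingroup all_algebra.
From mathcomp Require Import sesquilinear spectral.
From mathcomp Require Import complex reals.

Set Implicit Arguments.
Unset Strict Implicit.
Unset Printing Implicit Defensive.

Import Order.TTheory GRing.Theory Num.Theory.
Local Open Scope ring_scope.
Local Open Scope complex_scope.
Local Open Scope sesquilinear_scope.

Record sgraph := SGraph {
  vertex :> finType;
  adj : rel vertex;
  adj_sym : symmetric adj;
  adj_irr : irreflexive adj }.

Definition connected (G : sgraph) : Prop := forall a b : G, connect (@adj G) a b.

(* A back-and-forth walk along one edge is a [ucycle] of size 2, so circuits   *)
(* are the duplicate-free cycles of size at least 3.                           *)
Definition circuit_free (G : sgraph) : Prop :=
  forall c : seq G, ucycle (@adj G) c -> (size c < 3)%N.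

Definition is_tree (G : sgraph) : Prop := connected G /\ circuit_free G.

(* The set S_G of ordered pairs of adjacent vertices. *)
Definition dart (G : sgraph) : finType := {p : G * G | adj p.1 p.2}.

Definition dsrc (G : sgraph) (s : dart G) : G := (val s).1.
Definition dtgt (G : sgraph) (s : dart G) : G := (val s).2.

Lemma drev_subproof (G : sgraph) (s : dart G) : adj (dtgt s, dsrc s).1 (dtgt s, dsrc s).2.
Proof. by rewrite /= adj_sym; exact: (valP s). Qed.

Definition drev (G : sgraph) (s : dart G) : dart G :=
  exist _ (dtgt s, dsrc s) (drev_subproof s).

Definition is_orientation (G : sgraph) (Delta : {set dart G}) : Prop :=
  forall s : dart G, (s \in Delta) (+) (drev s \in Delta).

Definition is_configuration (R : realType) (G : sgraph) (x : G -> 'rV[R]_3) : Prop :=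
  forall a b : G, adj a b -> x a != x b.

Definition enorm (R : realType) (v : 'rV[R]_3) : R :=
  Num.sqrt (\sum_i v 0 i ^+ 2).

Definition direction (R : realType) (G : sgraph) (x : G -> 'rV[R]_3) (s : dart G) :
    'rV[R]_3 :=
  (enorm (x (dtgt s) - x (dsrc s)))^-1 *: (x (dtgt s) - x (dsrc s)).

Definition mx2 (R : realType) (a b c d : R[i]) : 'M[R[i]]_2 :=
  \matrix_(i < 2, j < 2)
    if i == 0 then (if j == 0 then a else b) else (if j == 0 then c else d).

Definition pauli1 (R : realType) : 'M[R[i]]_2 := mx2 0 1 1 0.
Definition pauli2 (R : realType) : 'M[R[i]]_2 := mx2 0 (- 'i%C) 'i%C 0.
Definition pauli3 (R : realType) : 'M[R[i]]_2 := mx2 1 0 0 (- 1).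

Definition dot_pauli (R : realType) (v : 'rV[R]_3) : 'M[R[i]]_2 :=
  (v 0 0)%:C *: pauli1 R + (v 0 1)%:C *: pauli2 R + (v 0 2%:R)%:C *: pauli3 R.

(* Each psi s is only determined up to a phase: [is_spinor_family x psi] says  *)
(* that psi is one of the admissible choices.                                  *)
Definition is_spinor_family (R : realType) (G : sgraph) (x : G -> 'rV[R]_3)
    (psi : dart G -> 'cV[R[i]]_2) : Prop :=
  forall s : dart G,
    \sum_i `|psi s i 0| ^+ 2 = 1 /\
    dot_pauli (direction x s) *m psi s = psi s.

Definition omega (R : realType) (u w : 'cV[R[i]]_2) : R[i] :=
  u 0 0 * w 1 0 - w 0 0 * u 1 0.

(* The tensor product of copies of C^2 indexed by S_G, in coordinates: the     *)
(* value of a tensor at f : S_G -> {0, 1} is its coefficient on the tensor     *)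
(* product of the standard basis vectors e_(f s).                              *)
Notation tensor R G := {ffun {ffun dart G -> 'I_2} -> (R[i])^o}.

Definition pure (R : realType) (G : sgraph) (phi : dart G -> 'cV[R[i]]_2) : tensor R G :=
  [ffun f : {ffun dart G -> 'I_2} => \prod_s phi s (f s) 0].

Definition tensor_act (R : realType) (G : sgraph) (t : tensor R G) (p : {perm dart G}) :
    tensor R G :=
  [ffun f : {ffun dart G -> 'I_2} => t [ffun s => f ((p^-1)%g s)]].

Lemma tensor_act_pure (R : realType) (G : sgraph) (phi : dart G -> 'cV[R[i]]_2)
    (p : {perm dart G}) :
  tensor_act (pure phi) p = pure (fun s => phi (p s)).
Proof.
apply/ffunP=> f; rewrite !ffunE (reindex_inj (@perm_inj _ p)) /=.
by apply: eq_bigr => s _; rewrite ffunE permK.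
Qed.

Lemma tensor_act_linear (R : realType) (G : sgraph) (p : {perm dart G}) :
  linear (fun t : tensor R G => tensor_act t p).
Proof. by move=> a t u; apply/ffunP=> f; rewrite !ffunE. Qed.

Definition contraction (R : realType) (G : sgraph) (Delta : {set dart G}) (t : tensor R G) :
    R[i] :=
  \sum_(f : {ffun dart G -> 'I_2})
    t f * \prod_(s in Delta) omega (delta_mx (f s) 0) (delta_mx (f (drev s)) 0).

Lemma drevK (G : sgraph) : involutive (@drev G).
Proof. by case=> -[a b] ab; apply: val_inj. Qed.

Lemma omegaE (R : realType) (u w : 'cV[R[i]]_2) :
  omega u w =
  \sum_(k : 'I_2 * 'I_2) u k.1 0 * w k.2 0 * omega (delta_mx k.1 0) (delta_mx k.2 0).
Proof.
rewrite -(pair_bigA _ (fun i j => u i 0 * w j 0 * omega (delta_mx i 0) (delta_mx j 0))) /=.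
rewrite !big_ord_recl !big_ord0 /omega !mxE /=.
have -> : lift ord0 ord0 = 1 :> 'I_2 by apply: val_inj.
have -> : ord0 = 0 :> 'I_2 by [].
rewrite !(mul0r, mulr0, mulr1, subrr, addr0, add0r, sub0r, subr0).
by rewrite mulrN mulr1 [w 0 0 * _]mulrC.
Qed.

Lemma contraction_pure (R : realType) (G : sgraph) (Delta : {set dart G})
    (phi : dart G -> 'cV[R[i]]_2) :
  is_orientation Delta ->
  contraction Delta (pure phi) = \prod_(s in Delta) omega (phi s) (phi (drev s)).
Proof.
move=> D_or.
have D_rev s : (drev s \in Delta) = (s \notin Delta).
  by have := D_or s; case: (s \in Delta); case: (drev s \in Delta).
pose F s (k : 'I_2 * 'I_2) : R[i] :=
  phi s k.1 0 * phi (drev s) k.2 0 * omega (delta_mx k.1 0) (delta_mx k.2 0).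
pose join (g : {ffun dart G -> 'I_2 * 'I_2}) : {ffun dart G -> 'I_2} :=
  [ffun s => if s \in Delta then (g s).1 else (g (drev s)).2].
pose cut (f : {ffun dart G -> 'I_2}) : {ffun dart G -> 'I_2 * 'I_2} :=
  [ffun s => if s \in Delta then (f s, f (drev s)) else (0, 0)].
rewrite (eq_bigr (fun s => \sum_k F s k)) => [|s _]; last exact: omegaE.
rewrite (big_distr_big (0, 0)) /contraction (reindex_onto join cut) => [|f _]; last first.
  apply/ffunP=> s; rewrite !ffunE D_rev drevK.
  by case: (s \in Delta).
apply: eq_big => [g|g _].
  apply/eqP/pffun_onP => [<-|[/subsetP supp _]].
    split=> [|? _] //; apply/subsetP=> s; rewrite inE ffunE.
    by case: ifP => //; rewrite eqxx.
  apply/ffunP=> s; rewrite !ffunE D_rev drevK; case: ifP => sD /=; first by rewrite sD -surjective_pairing.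
  apply/esym/eqP; apply: contraFT sD => gs; exact: supp.
rewrite ffunE (bigID (mem Delta)) /=.
rewrite [X in _ * X * _](reindex_inj (inv_inj (@drevK G))) /=.
rewrite [X in _ * X * _](eq_bigl (mem Delta)) => [|s]; last by rewrite /= D_rev negbK.
rewrite -!big_split /=; apply: eq_bigr => s sD.
by rewrite /F !ffunE D_rev sD drevK.
Qed.

(* The group P_G of permutations of S_G preserving first entries. *)
Definition src_perm (G : sgraph) : {set {perm dart G}} :=
  [set p : {perm dart G} | [forall s, dsrc (p s) == dsrc s]].

Definition graph_tensor (R : realType) (G : sgraph) (psi : dart G -> 'cV[R[i]]_2)
    (Delta : {set dart G}) : tensor R G :=
  (\prod_(s in Delta) omega (psi s) (psi (drev s)))^-1 *: pure psi.

Definition amplitude (R : realType) (G : sgraph) (psi : dart G -> 'cV[R[i]]_2)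
    (Delta : {set dart G}) : R[i] :=
  contraction Delta (\sum_(p in src_perm G) tensor_act (graph_tensor psi Delta) p).

Definition psd_hermitian (R : realType) (m : nat) (A : 'M[R[i]]_m) : Prop :=
  A \is hermsymmx /\ forall v : 'cV[R[i]]_m, 0 <= (v ^t* *m A *m v) 0 0.

Definition class_perm (m : nat) (r : rel 'I_m) : {set {perm 'I_m}} :=
  [set p : {perm 'I_m} | [forall i, p @: [set j | r i j] == [set j | r i j]]].

(* The right-hand side is real because A is Hermitian; the order on R[i] is    *)
(* then the usual one between real numbers.                                    *)
Definition statement_D (R : realType) : Prop :=
  forall (m : nat) (r1 r2 : rel 'I_m) (A : 'M[R[i]]_m),
    (0 < m)%N -> equivalence_rel r1 -> equivalence_rel r2 -> psd_hermitian A ->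
    #|class_perm r1 :&: class_perm r2|%:R * \prod_i A i i
      <= 'Re (\sum_(s1 in class_perm r1) \sum_(s2 in class_perm r2)
                \prod_i A (s1 i) (s2 i)).

(* Main.v *)
(* A tree is bipartite; orient every edge from black to white, and index the
   edges by [m].  A source-preserving permutation of the darts is then a pair
   [(q1, q2)] where [q1] permutes the edges at each black vertex and [q2] those at
   each white vertex.  The spinor of a reversed dart is orthogonal to that of the
   dart, so in dimension two
     omega (psi s) (psi (drev t)) = omega (psi t) (psi (drev t)) * <psi s, psi t>.
   The first factors multiply to the normalisation of the amplitude, which thus
   equals the double sum of (D) for the Gram matrix of the spinors.  That matrix is
   positive semidefinite with unit diagonal. *)
Require Import Defs.
From mathcomp Require Import all_boot all_order all_fingroup all_algebra.
From mathcomp Require Import complex reals sesquilinear spectral ring.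

Set Implicit Arguments.
Unset Strict Implicit.
Unset Printing Implicit Defensive.

Import Order.TTheory GRing.Theory Num.Theory.
Local Open Scope ring_scope.
Local Open Scope complex_scope.
Local Open Scope sesquilinear_scope.

(** * Trees are bipartite *)

Lemma not_uniq_split (U : eqType) (s : seq U) :
  ~~ uniq s -> exists y s1 s2 s3, s = s1 ++ y :: s2 ++ y :: s3.
Proof.
elim: s => [//|a s IHs] /=; rewrite negb_and negbK => /orP[|/IHs].
  by case/splitPr=> s2 s3; exists a, [::], s2, s3.
by case=> [y [s1 [s2 [s3 ->]]]]; exists y, (a :: s1), s2, s3.
Qed.

(* A shortest odd closed walk has no repeated vertex, hence is a circuit. *)
Lemma circuit_free_closed_walk_even (G : sgraph) (x : G) (p : seq G) :
  circuit_free G -> path (@adj G) x p -> last x p = x -> ~~ odd (size p).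
Proof.
move=> cfG; have [n] := ubnP (size p).
elim: n x p => // n IHn x p; rewrite ltnS => le_pn xp lastp.
have [up|/not_uniq_split[y [s1 [s2 [s3 def_p]]]]] := boolP (uniq p).
  case/lastP: p => [//|q z] in xp lastp up {le_pn} *.
  rewrite last_rcons in lastp; rewrite {z}lastp in xp up *.
  have ucq : ucycle (@adj G) (x :: q).
    by rewrite /ucycle /= xp -(rcons_uniq q x).
  have := cfG _ ucq; rewrite size_rcons /=.
  (* [q] has at most one entry: an empty [q] would give a loop at [x], and a single entry gives a
     closed walk of length 2. *)
  by case: q {up ucq} xp => [|? [|]] //=; rewrite adj_irr.
rewrite {p}def_p !(cat_path, last_cat, size_cat) /= !(cat_path, last_cat, size_cat) /=
  in le_pn xp lastp *.
case/and4P: xp => xs1 s1y ys2 /andP[s2y ys3].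
(* The repeated vertex [y] cuts the walk into two shorter closed walks, at [y] and at [x], whose
   lengths add up to the original one. *)
have ev1 : ~~ odd (size (rcons s2 y)).
  apply: (IHn y); last by rewrite last_rcons.
    apply: leq_trans le_pn; rewrite size_rcons !addnS !ltnS.
    by rewrite addnCA leq_addr.
  by rewrite rcons_path ys2.
have ev2 : ~~ odd (size (s1 ++ y :: s3)).
  apply: (IHn x); last by rewrite last_cat.
    apply: leq_trans le_pn; rewrite size_cat /= !addnS !ltnS.
    by rewrite leq_add2l leq_addl.
  by rewrite cat_path /= xs1 s1y.
move: ev1 ev2; rewrite size_rcons !(size_cat, addnS) /= ?addnS /= !oddD !negbK.
by case: odd; case: odd; case: odd.
Qed.

(** Colour a vertex by the parity of a chosen walk from a root. For an edge [ab], the walk to [a],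
    the edge and the reversed walk from [b] close up, so their total length is even. *)
Lemma tree_bicoloring (G : sgraph) :
  is_tree G -> exists c : G -> bool, forall a b, adj a b -> c a (+) c b.
Proof.
case=> conG cfG.
have [r _|G0] := pickP (@predT G); last by exists (fun=> true) => a; have := G0 a.
have [] := fin_all_exists (P := fun a p => path (@adj G) r p /\ a = last r p).
  by move=> a; have /connectP[p] := conG r a; exists p.
move=> walk walkP; exists (fun a => odd (size (walk a))) => a b ab.
have [ra def_a] := walkP a; have [rb def_b] := walkP b.
have closed : path (@adj G) r (walk a ++ b :: rev (belast r (walk b))).
  rewrite cat_path /= -def_a ra ab {1}def_b rev_path.
  by rewrite (eq_path (e' := @adj G)) // => u v; apply: adj_sym.
have := circuit_free_closed_walk_even cfG closed.
rewrite last_cat /= size_cat /= size_rev size_belast addnS /= oddD negbK.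
apply; case: {rb closed} (walk b) def_b => [|? ?] //= _.
by rewrite rev_cons last_rcons.
Qed.

(** * Spinors of opposite darts and their Gram matrix *)

Lemma dot_pauliN (R : realType) (v : 'rV[R]_3) : dot_pauli (- v) = - dot_pauli v.
Proof. by rewrite /dot_pauli !mxE !rmorphN /= !scaleNr !opprD. Qed.

Lemma dot_pauli_adjoint (R : realType) (v : 'rV[R]_3) :
  (dot_pauli v) ^t* = dot_pauli v.
Proof.
have conjR (a : R) : (a%:C)^*%R = a%:C by exact: conjc_real.
have conji : ('i%C : R[i])^*%R = - 'i%C by apply/eqP; rewrite eq_complex /= oppr0 !eqxx.
apply/matrixP=> i j; rewrite !mxE !rmorphD !rmorphM /= !conjR.
by case: (boolP (i == 0)); case: (boolP (j == 0));
  rewrite ?(rmorphN, rmorph0, rmorph1) /= ?rmorphN ?conji ?opprK.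
Qed.

Lemma adjoint_mul (R : realType) m n p (A : 'M[R[i]]_(m, n)) (B : 'M[R[i]]_(n, p)) :
  (A *m B) ^t* = B ^t* *m A ^t*.
Proof. by rewrite trmx_mul map_mxM. Qed.

Lemma direction_rev (R : realType) (G : sgraph) (x : G -> 'rV[R]_3) (s : dart G) :
  direction x (drev s) = - direction x s.
Proof.
rewrite /direction /= -scalerN opprB; congr (_^-1 *: _); congr Num.sqrt.
by apply: eq_bigr => i _; rewrite !mxE -sqrrN opprB.
Qed.

(** The two spinors are eigenvectors of one Hermitian matrix, for the eigenvalues 1 and -1. *)
Lemma spinor_rev_orthogonal (R : realType) (G : sgraph) (x : G -> 'rV[R]_3)
    (psi : dart G -> 'cV[R[i]]_2) (s : dart G) :
  is_spinor_family x psi -> (psi s) ^t* *m psi (drev s) = 0.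
Proof.
move=> hpsi; have [_ eig] := hpsi s; have [_] := hpsi (drev s).
rewrite direction_rev dot_pauliN mulNmx => eigN.
have : (psi s) ^t* *m psi (drev s) = - ((psi s) ^t* *m psi (drev s)).
  rewrite -{2}eigN mulmxN opprK mulmxA -{1}eig adjoint_mul.
  by rewrite dot_pauli_adjoint.
move/eqP; rewrite -addr_eq0 -mulr2n -scaler_nat scaler_eq0 pnatr_eq0.
by move/eqP.
Qed.

Definition cdot (R : realType) (u w : 'cV[R[i]]_2) : R[i] := \sum_k u k 0 * (w k 0)^*%R.

Lemma cdot_spinor (R : realType) (G : sgraph) (x : G -> 'rV[R]_3)
    (psi : dart G -> 'cV[R[i]]_2) (s : dart G) :
  is_spinor_family x psi -> cdot (psi s) (psi s) = 1.
Proof.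
move=> hpsi; have [<- _] := hpsi s.
by apply: eq_bigr => k _; rewrite normCK.
Qed.

(* In C^2 the orthogonal complement of [w := psi s] is spanned by the vector
   [z := (- conj w_1, conj w_0)], and [omega u z = cdot u w]. *)
Lemma omega_spinor_rev (R : realType) (G : sgraph) (x : G -> 'rV[R]_3)
    (psi : dart G -> 'cV[R[i]]_2) (u : 'cV[R[i]]_2) (s : dart G) :
  is_spinor_family x psi ->
  omega u (psi (drev s)) = omega (psi s) (psi (drev s)) * cdot u (psi s).
Proof.
move=> hpsi; have := cdot_spinor s hpsi.
have /matrixP/(_ 0 0) := spinor_rev_orthogonal s hpsi.
rewrite /cdot !mxE !big_ord_recl !big_ord0 /= !addr0 !mxE /omega.
have -> : lift ord0 ord0 = 1 :> 'I_2 by apply: val_inj.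
have -> : ord0 = 0 :> 'I_2 by [].
move: (psi s) (psi (drev s)) => w z.
set a := (w 0 0)^*%R; set b := (w 1 0)^*%R => orth unit.
(* Multiplying [z 0 0] by the norm identity [unit] turns the difference of the sides into a multiple
   of the left side of [orth]. *)
have zE0 : z 0 0 = - b * (w 0 0 * z 1 0 - z 0 0 * w 1 0).
  apply/eqP; rewrite -subr_eq0 -[X in X - _]mul1r -unit; apply/eqP.
  transitivity (w 0 0 * (a * z 0 0 + b * z 1 0)); first by ring.
  by rewrite orth mulr0.
have zE1 : z 1 0 = a * (w 0 0 * z 1 0 - z 0 0 * w 1 0).
  apply/eqP; rewrite -subr_eq0 -[X in X - _]mul1r -unit; apply/eqP.
  transitivity (w 1 0 * (a * z 0 0 + b * z 1 0)); first by ring.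
  by rewrite orth mulr0.
by rewrite {1}zE0 {1}zE1; ring.
Qed.

(** Otherwise [psi (drev s)] would pair to zero with every vector and hence vanish, against its unit
    norm. *)
Lemma omega_spinor_rev_neq0 (R : realType) (G : sgraph) (x : G -> 'rV[R]_3)
    (psi : dart G -> 'cV[R[i]]_2) (s : dart G) :
  is_spinor_family x psi -> omega (psi s) (psi (drev s)) != 0.
Proof.
move=> hpsi; apply: contraTneq isT => om0.
have omr u : omega u (psi (drev s)) = 0.
  by rewrite (omega_spinor_rev u s hpsi) om0 mul0r.
have /eqP := cdot_spinor (drev s) hpsi.
have := omr (delta_mx 0 0); have := omr (delta_mx 1 0).
rewrite /cdot /omega !mxE /= !big_ord_recl big_ord0.
have -> : lift ord0 ord0 = 1 :> 'I_2 by apply: val_inj.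
have -> : ord0 = 0 :> 'I_2 by [].
rewrite mul0r mulr1 mul1r mulr0 sub0r subr0 => /eqP; rewrite oppr_eq0 => /eqP-> ->.
by rewrite !mul0r !addr0 eq_sym oner_eq0.
Qed.

Lemma psd_gram (R : realType) m (u : 'I_m -> 'cV[R[i]]_2) :
  psd_hermitian (\matrix_(i, j) cdot (u i) (u j)).
Proof.
pose X : 'M[R[i]]_(m, 2) := \matrix_(i, k) u i k 0.
have -> : \matrix_(i, j) cdot (u i) (u j) = X *m X ^t*.
  by apply/matrixP=> i j; rewrite !mxE; apply: eq_bigr => k _; rewrite !mxE.
split=> [|v].
  by apply/is_hermitianmxP; rewrite expr0 scale1r adjoint_mul trmxCK.
(* The quadratic form is the squared norm of the row [v ^t* *m X]. *)
rewrite mulmxA -mulmxA -[v ^t* *m X]trmxCK adjoint_mul trmxCK mxE.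
by apply: sumr_ge0 => k _; rewrite !mxE mulrC mul_conjC_ge0.
Qed.

(** * The amplitude as a permutation sum, for any orientation *)

Lemma orientation_rev (G : sgraph) (D : {set dart G}) (s : dart G) :
  is_orientation D -> (drev s \in D) = (s \notin D).
Proof. by move=> /(_ s); case: (s \in D); case: (drev s \in D). Qed.

Lemma prod_orientation (R : realType) (G : sgraph) (D1 D2 : {set dart G})
    (F : dart G -> R[i]) :
  is_orientation D1 -> is_orientation D2 -> (forall s, F (drev s) = F s) ->
  \prod_(s in D1) F s = \prod_(s in D2) F s.
Proof.
move=> oD1 oD2 Frev; rewrite (bigID (mem D2)) [RHS](bigID (mem D1)) /=; congr (_ * _).
  by apply: eq_bigl => s; rewrite andbC.
(* The darts of [D1] outside [D2] are the reverses of those of [D2] outside [D1]. *)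
rewrite (reindex_inj (inv_inj (@drevK G))) /=.
apply: eq_big => [s|s _]; last exact: Frev.
by rewrite !orientation_rev // negbK andbC.
Qed.

Lemma omega_skew (R : realType) (u w : 'cV[R[i]]_2) : omega w u = - omega u w.
Proof. by rewrite /omega opprB. Qed.

Lemma amplitudeE (R : realType) (G : sgraph) (psi : dart G -> 'cV[R[i]]_2)
    (D : {set dart G}) :
  is_orientation D ->
  amplitude psi D =
  \sum_(p in src_perm G) \prod_(s in D)
    (omega (psi (p s)) (psi (p (drev s))) / omega (psi s) (psi (drev s))).
Proof.
move=> oD; rewrite /amplitude /contraction.
under eq_bigr => f _ do rewrite sum_ffunE mulr_suml.
rewrite exchange_big /=; apply: eq_bigr => p _.
rewrite prodf_div -(contraction_pure (fun s => psi (p s)) oD) -tensor_act_pure.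
rewrite mulrC /contraction mulr_sumr; apply: eq_bigr => f _.
by rewrite /graph_tensor !ffunE mulrA.
Qed.

(** Reversing a dart changes the sign of both numerator and denominator of its factor. *)
Lemma amplitude_orientation (R : realType) (G : sgraph) (psi : dart G -> 'cV[R[i]]_2)
    (D1 D2 : {set dart G}) :
  is_orientation D1 -> is_orientation D2 -> amplitude psi D1 = amplitude psi D2.
Proof.
move=> oD1 oD2; rewrite !amplitudeE //; apply: eq_bigr => p _.
apply: prod_orientation => // s; rewrite drevK.
by rewrite omega_skew [X in _ / X]omega_skew invrN mulrNN.
Qed.

(** * Splitting source-preserving permutations by colour *)

Lemma mem_class_perm m (U : eqType) (f : 'I_m -> U) (p : {perm 'I_m}) :
  (p \in class_perm (fun i j => f i == f j)) = [forall i, f (p i) == f i].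
Proof.
rewrite inE; apply/forallP/forallP => H i; last first.
  (* By injectivity of [p], it suffices that each class is mapped into itself. *)
  rewrite eqEcard card_imset ?leqnn ?andbT; last exact: perm_inj.
  apply/subsetP=> k /imsetP[j]; rewrite !inE => /eqP-> ->.
  by rewrite eq_sym.
have : p i \in [set j | f i == f j] by rewrite -(eqP (H i)) imset_f ?inE.
by rewrite inE eq_sym.
Qed.

Section SplitSourcePermutations.
Variables (G : sgraph) (B : {set dart G}) (s0 : dart G) (Bs0 : s0 \in B).
Hypotheses (oB : is_orientation B)
  (srcB : forall s t : dart G, dsrc s = dsrc t -> (s \in B) = (t \in B)).

Let m := #|B|.
Let e : 'I_m -> dart G := enum_val.
Let rk : dart G -> 'I_m := enum_rank_in Bs0.

Let eB i : e i \in B. Proof. exact: enum_valP. Qed.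
Let erk s : s \in B -> e (rk s) = s. Proof. exact: enum_rankK_in. Qed.
Let rke i : rk (e i) = i. Proof. exact: enum_valK_in. Qed.
Let revB s : (drev s \in B) = (s \notin B). Proof. exact: orientation_rev. Qed.

(** Darts outside [B] are moved through their reverses, so both components of [q] act on the same
    edge indices. *)
Let glue_fun (q : 'S_m * 'S_m) (s : dart G) : dart G :=
  if s \in B then e (q.1 (rk s)) else drev (e (q.2 (rk (drev s)))).

Let mem_glue_fun q s : (glue_fun q s \in B) = (s \in B).
Proof. by rewrite /glue_fun; case: ifP; rewrite ?revB eB. Qed.

Let glue_inj q : injective (glue_fun q).
Proof.
move=> s t eq_st; have := mem_glue_fun q s; rewrite eq_st mem_glue_fun => eqB.
move: eq_st; rewrite /glue_fun eqB; case: ifPn => sB.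
  by move/(can_inj rke)/perm_inj/(congr1 e); rewrite !erk ?eqB.
move/(can_inj (@drevK G))/(can_inj rke)/perm_inj/(congr1 e).
by rewrite !erk ?revB ?eqB //; apply: (can_inj (@drevK G)).
Qed.

Let glue q : {perm dart G} := perm (@glue_inj q).

Let glue_e q i : glue q (e i) = e (q.1 i).
Proof. by rewrite permE /glue_fun eB rke. Qed.

Let glue_rev_e q i : glue q (drev (e i)) = drev (e (q.2 i)).
Proof. by rewrite permE /glue_fun revB eB drevK rke. Qed.

Let P1 := class_perm (fun i j => dsrc (e i) == dsrc (e j)).
Let P2 := class_perm (fun i j => dtgt (e i) == dtgt (e j)).

(** By [srcB] a source-preserving permutation stabilises [B] and its complement. Reversal turns
    sources outside [B] into targets of darts in [B], whence [dtgt] in [P2]. *)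
Let glue_image : glue @: setX P1 P2 = src_perm G.
Proof.
apply/setP=> p; apply/imsetP/idP => [[[q1 q2]]|].
  rewrite in_setX !mem_class_perm => /andP[/forallP/= q1P /forallP/= q2P] ->.
  rewrite inE; apply/forallP=> s; have [sB|sB] := boolP (s \in B).
    by rewrite -(erk sB) glue_e q1P.
  have rsB : drev s \in B by rewrite revB.
  by rewrite -[s]drevK -(erk rsB) glue_rev_e /= q2P.
rewrite inE => /forallP pP.
have pB s : (p s \in B) = (s \in B) by apply: srcB; apply/eqP.
have rpB i : drev (p (drev (e i))) \in B by rewrite revB pB revB eB.
have inj1 : injective (fun i => rk (p (e i))).
  move=> i j /(congr1 e); rewrite !erk ?pB ?eB //.
  by move/perm_inj/(can_inj rke).
have inj2 : injective (fun i => rk (drev (p (drev (e i))))).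
  move=> i j /(congr1 e); rewrite !erk //.
  by move/(can_inj (@drevK G))/perm_inj/(can_inj (@drevK G))/(can_inj rke).
exists (perm inj1, perm inj2).
  rewrite in_setX !mem_class_perm; apply/andP; split; apply/forallP=> i /=.
    by rewrite permE erk ?pB ?eB.
  by rewrite permE erk //; exact: (pP (drev (e i))).
apply/permP=> s; have [sB|sB] := boolP (s \in B).
  by rewrite -{2}(erk sB) glue_e permE !erk ?pB.
have rsB : drev s \in B by rewrite revB.
by rewrite -{2}[s]drevK -(erk rsB) glue_rev_e permE !erk ?revB ?pB ?drevK.
Qed.

Lemma sum_src_perm_split (R : realType) (F : dart G -> dart G -> R[i]) :
  \sum_(p in src_perm G) \prod_(s in B) F (p s) (p (drev s)) =
  \sum_(q1 in P1) \sum_(q2 in P2) \prod_i F (e (q1 i)) (drev (e (q2 i))).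
Proof.
rewrite -glue_image big_imset /= => [|[q1 q2] [q1' q2'] _ _ eq_q].
  rewrite pair_big /=; apply: eq_big => [[q1 q2]|q _]; first by rewrite in_setX.
  by rewrite big_enum_val; apply: eq_bigr => i _; rewrite glue_e glue_rev_e.
congr (_, _); apply/permP=> i; apply: (can_inj rke).
  by have := glue_e (q1, q2) i; rewrite eq_q glue_e.
apply: (can_inj (@drevK G)).
by have := glue_rev_e (q1, q2) i; rewrite eq_q glue_rev_e.
Qed.

End SplitSourcePermutations.

(** * Applying (D) to the Gram matrix *)

Theorem mainTheorem7 (R : realType) (hD : statement_D R)
    (T : sgraph) (hT : is_tree T)
    (x : T -> 'rV[R]_3) (hx : is_configuration x)
    (psi : dart T -> 'cV[R[i]]_2) (hpsi : is_spinor_family x psi)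
    (Delta : {set dart T}) (hDelta : is_orientation Delta) :
  1 <= 'Re (amplitude psi Delta).
Proof.
have [c c_adj] := tree_bicoloring hT.
pose B := [set s : dart T | c (dsrc s)].
have oB : is_orientation B by move=> s; rewrite !inE; exact: c_adj (valP s).
have srcB (s t : dart T) : dsrc s = dsrc t -> (s \in B) = (t \in B).
  by rewrite !inE => ->.
rewrite (amplitude_orientation psi hDelta oB) amplitudeE //.
(* (D) requires a positive size. Without edges all products are empty, and the amplitude counts
   [src_perm T], which contains the identity. *)
have [s0 Bs0|B0] := pickP (mem B); last first.
  under eq_bigr => p _ do rewrite big_pred0 //.
  rewrite sumr_const (Creal_ReP _ _) ?realn // ler1n.
  by apply/card_gt0P; exists 1%g; rewrite inE; apply/forallP=> s; rewrite perm1.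
pose e : 'I_#|B| -> dart T := enum_val.
pose u i := psi (e i).
pose om s := omega (psi s) (psi (drev s)).
have om0 s : om s != 0 by exact: omega_spinor_rev_neq0 hpsi.
under eq_bigr => p _ do rewrite prodf_div.
rewrite -mulr_suml (sum_src_perm_split Bs0 oB srcB (fun s t => omega (psi s) (psi t))).
have prod_om0 : \prod_(s in B) om s != 0 by apply/prodf_neq0.
have m_gt0 : (0 < #|B|)%N by apply/card_gt0P; exists s0.
pose same_end (f : dart T -> T) i j := f (e i) == f (e j).
have same_equiv f : equivalence_rel (same_end f).
  by move=> i j k; split=> [|/eqP ij]; rewrite /same_end ?eqxx ?ij.
have := hD _ _ _ _ m_gt0 (same_equiv (@dsrc T)) (same_equiv (@dtgt T)) (psd_gram u).
rewrite [X in _ * X]big1 => [|i _]; last by rewrite mxE; exact: cdot_spinor hpsi.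
rewrite mulr1 => D_le.
have one_le : 1 <= #|class_perm (same_end (@dsrc T)) :&: class_perm (same_end (@dtgt T))|%:R
    :> R[i].
  rewrite ler1n; apply/card_gt0P; exists 1%g; rewrite inE !mem_class_perm.
  by apply/andP; split; apply/forallP=> i; rewrite perm1.
(* What remains is an equality: the double sum of (D) is the amplitude itself. *)
apply: le_trans (le_trans one_le D_le) _; rewrite le_eqVlt; apply/orP; left.
apply/eqP; congr ('Re _); apply: canRL (mulfK prod_om0) _.
rewrite mulr_suml; apply: eq_bigr => q1 _; rewrite mulr_suml; apply: eq_bigr => q2 _.
(* Reindexing the normalisation by [q2] pairs the Gram entry at [(q1 i, q2 i)] with the factor
   [om (e (q2 i))] that it needs. *)
rewrite [X in _ * X]big_enum_val /= [X in _ * X](reindex_inj (@perm_inj _ q2)) -big_split /=.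
by apply: eq_bigr => i _; rewrite mxE (omega_spinor_rev _ _ hpsi) mulrC.
Qed.
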